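(* Let $f:E\to\mathbb{R}$ be an $L$-smooth convex function, let $\varphi:C\to\mathbb{R}$ be $\sigma$-strongly convex ($\sigma>0$) and twice continuously differentiable, let $x^*$ be a minimizer of $f$ over $C$, and let $z^*\in E^*$ satisfy $\nabla\varphi^*(z^* )=x^*$. Let $X:[0,\infty)\to E$ and $Z:[0,\infty)\to E^*$ be differentiable functions solving $$\dot Z(t)=-\sigma\nabla f(X(t)),\qquad X(t)=\nabla\varphi^*(Z(t)),\qquad Z(0)=z_0,\quad X(0)=x_0,$$ where $\nabla\varphi^*(z_0)=x_0$. Then for all $t>0$ $$f(X(t))-f(x^* )\le\frac{D_{\varphi^*}(z_0,z^* )}{t\sigma},$$ and, as $t\to\infty$, $$\inf_{0\le u\le t}\|\dot X(u)\|^2=o\left(\frac{1}{t^2}\right).$$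
   Context: $E$ is a finite-dimensional real vector space with norm $\|\cdot\|$, $E^*$ its dual with dual norm $\|\cdot\|_*$, and $\langle s,x\rangle$ denotes the value of $s\in E^*$ at $x\in E$. $C\subseteq E$ is a nonempty closed convex set. $f$ is $L$-smooth convex if it is convex, differentiable and $\|\nabla f(x)-\nabla f(y)\|_*\le L\|x-y\|$ for all $x,y$. The convex function $\varphi$ on $C$ is extended by $+\infty$ outside $C$; twice continuously differentiable on $C$ means it is the restriction to $C$ of a twice continuously differentiable function on an open neighbourhood of $C$. It is $\sigma$-strongly convex if $\varphi(y)-\varphi(x)-\langle g,y-x\rangle\ge\frac{\sigma}{2}\|y-x\|^2$ for all $x,y\in C$ and $g\in\partial\varphi(x)$. The conjugate is $\varphi^*(s)=\sup_{x\in E}\{\langle s,x\rangle-\varphi(x)\}$, which is finite and differentiable on $E^*$, with $\nabla \varphi^*$ taking values in $C$. The Bregman divergence of $\varphi^*$ is $D_{\varphi^*}(z,w)=\varphi^*(z)-\varphi^*(w)-\langle z-w,\nabla\varphi^*(w)\rangle$. A minimizer $x^*$ of $f$ over $C$ is assumed to exist. *)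

(* Defs.v *)
From HB Require Import structures.
From mathcomp Require Import all_boot all_order all_algebra.
From mathcomp Require Import all_classical all_reals all_analysis.

Set Implicit Arguments.
Unset Strict Implicit.
Unset Printing Implicit Defensive.

Import Order.TTheory GRing.Theory Num.Theory.
Import numFieldNormedType.Exports.
Local Open Scope classical_set_scope.
Local Open Scope ring_scope.

#[short(type="normedVectType")]
HB.structure Definition NormedVector (R : numFieldType) :=
  {E of NormedModule R E & Vector R E}.

(* The scalar field as a normed space of dimension 1 over itself. *)
HB.instance Definition _ (R : realType) := NormedModule.on R^o.
#[non_forgetful_inheritance]
HB.instance Definition _ (R : realType) := NormedModule.copy R R^o.

Section FiniteDimension.
Import VectorInternalTheory.
Context {R : realType}.

Lemma rV_linear_bounded (n : nat) (F : normedModType R)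
    (g : {linear 'rV[R]_n -> F}) :
  exists2 M, 0 <= M & forall v, `|g v| <= M * `|v|.
Proof.
exists (\sum_i `|g (delta_mx 0 i)|); first exact: sumr_ge0.
move=> v; rewrite {1}(row_sum_delta v) linear_sum mulr_suml.
apply: le_trans (ler_norm_sum _ _ _) _; apply: ler_sum => i _.
rewrite linearZ normrZ mulrC ler_wpM2l//.
rewrite [leRHS]/Num.norm /= mx_normrE; apply/bigmax_geP; right => /=.
by exists (0, i).
Qed.

Lemma vect_linear_bounded (E : normedVectType R) (F : normedModType R)
    (g : {linear E -> F}) :
  exists2 M, 0 <= M & forall x, `|g x| <= M * `|x|.
Proof.
have [A A0 hA] := rV_linear_bounded [the {linear 'rV[R]_(dim E) -> F} of g \o r2v].
have [B B0 hB] := rV_linear_bounded [the {linear 'rV[R]_(dim E) -> E} of r2v].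
suff [c c0 hc] : exists2 c, 0 < c & forall x : E, `|v2r x| <= c * `|x|.
  exists (A * c); first by rewrite mulr_ge0// ltW.
  move=> x; rewrite -mulrA; apply: le_trans (ler_wpM2l A0 (hc x)).
  by rewrite -{1}(v2rK x); exact: hA.
pose S := [set v : 'rV[R]_(dim E) | `|v| = 1].
have cS : compact S.
  apply: bounded_closed_compact.
    by exists 1; split => // M M1 v /= ->; exact: ltW.
  rewrite (_ : S = Num.norm @^-1` [set 1 : R]); last by apply/seteqP; split.
  apply: (closed_comp (f := fun v : 'rV[R]_(dim E) => `|v| : R)); last exact: closed_eq.
  by move=> v _; exact: norm_continuous.
have [S0|S0] := pselect (S !=set0); last first.
  exists 1 => // x; have [-> |x0] := eqVneq (v2r x) 0.
    by rewrite normr0 mul1r.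
  by exfalso; apply: S0; exists (`|v2r x|^-1 *: v2r x); exact: normfZV.
have cg : continuous (fun v : 'rV[R]_(dim E) => `|r2v v : E| : R).
  move=> v; apply: (@continuous_comp _ _ _ (r2v : 'rV[R]_(dim E) -> E) Num.norm).
    apply: (bounded_linear_continuous (f := [the {linear 'rV[R]_(dim E) -> E} of r2v])).
    apply/linear_boundedP; near=> r => w.
    by apply: le_trans (hB w) _; rewrite ler_wpM2r//; near: r; exact: nbhs_pinfty_ge.
  exact: norm_continuous.
have [v Sv hv] := compact_EVT_min S0 cS (continuous_subspaceT cg).
have nv0 : 0 < `|r2v v : E|.
  rewrite normr_gt0; apply/eqP => r0; move: Sv; rewrite inE /S /= -(r2vK v) r0.
  by rewrite linear0 normr0 => /esym/eqP; rewrite oner_eq0.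
exists (`|r2v v : E|^-1); first by rewrite invr_gt0.
move=> x; have [-> |x0] := eqVneq (v2r x) 0.
  by rewrite normr0 mulr_ge0// invr_ge0.
rewrite ler_pdivlMl//.
have := hv (`|v2r x|^-1 *: v2r x).
rewrite inE /S /= normfZV// => /(_ erefl).
rewrite linearZ /= v2rK normrZ normfV normr_id => h.
by rewrite mulrC -ler_pdivlMl// normr_gt0.
Unshelve. all: by end_near. Qed.

End FiniteDimension.

Section OperatorNorm.
Context {R : realType} (E F : normedVectType R).
Implicit Types s : 'Hom(E, F).

Definition opnorm s : R := sup [set `|s x| | x in [set x : E | `|x| <= 1]].

Lemma opnorm_has_sup s : has_sup [set `|s x| | x in [set x : E | `|x| <= 1]].
Proof.
split; first by exists `|s 0|, 0 => //=; rewrite normr0.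
have [M M0 hM] := vect_linear_bounded s.
exists M => _ [x /= x1 <-]; apply: le_trans (hM x) _.
by rewrite -[leRHS]mulr1 ler_wpM2l.
Qed.

Lemma opnorm_ub s x : `|x| <= 1 -> `|s x| <= opnorm s.
Proof.
by move=> x1; apply: ub_le_sup; [case: (opnorm_has_sup s)|exists x].
Qed.

Lemma opnorm_le s (M : R) :
  (forall x, `|x| <= 1 -> `|s x| <= M) -> opnorm s <= M.
Proof.
move=> h; apply: ge_sup; first by case: (opnorm_has_sup s).
by move=> _ [x x1 <-]; exact: h.
Qed.

Lemma le_opnorm s x : `|s x| <= opnorm s * `|x|.
Proof.
have [-> |x0] := eqVneq x 0; first by rewrite linear0 !normr0 mulr0.
have := @opnorm_ub s (`|x|^-1 *: x); rewrite normfZV// => /(_ (lexx _)).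
by rewrite linearZ normrZ normfV normr_id mulrC ler_pdivrMr// normr_gt0.
Qed.

Lemma opnorm_normD s s' : opnorm (s + s') <= opnorm s + opnorm s'.
Proof.
apply: opnorm_le => x x1; rewrite add_lfunE.
by apply: le_trans (ler_normD _ _) _; rewrite lerD// opnorm_ub.
Qed.

Lemma opnorm_ge0 s : 0 <= opnorm s.
Proof. by apply: (le_trans (normr_ge0 (s 0))); apply: opnorm_ub; rewrite normr0. Qed.

Lemma opnormZ (l : R) s : opnorm (l *: s) = `|l| * opnorm s.
Proof.
have le_opZ (k : R) s1 : opnorm (k *: s1) <= `|k| * opnorm s1.
  by apply: opnorm_le => x x1; rewrite scale_lfunE normrZ ler_wpM2l// opnorm_ub.
apply/eqP; rewrite eq_le le_opZ /=.
have [->|l0] := eqVneq l 0; first by rewrite normr0 mul0r opnorm_ge0.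
have := le_opZ l^-1 (l *: s); rewrite scalerA mulVf// scale1r normfV.
by rewrite ler_pdivlMl// normr_gt0.
Qed.

Lemma opnorm_eq0 s : opnorm s = 0 -> s = 0.
Proof.
move=> s0; apply/lfunP => x; rewrite zero_lfunE; apply/eqP.
by rewrite -normr_le0; apply: le_trans (le_opnorm s x) _; rewrite s0 mul0r.
Qed.

HB.instance Definition _ := Lmodule_isNormed.Build R 'Hom(E, F)
  opnorm_normD opnormZ opnorm_eq0.

End OperatorNorm.

Section ConvexAnalysis.
Context {R : realType} {E : normedVectType R}.

Definition grad (f : E -> R) (x : E) : 'Hom(E, R) := linfun ('d f x).

(* E is identified with its bidual: the gradient of a function on the dual is
   the point of E at which evaluation is the differential. *)
Definition dual_grad (g : 'Hom(E, R) -> R) (s : 'Hom(E, R)) : E :=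
  get [set x : E | forall d : 'Hom(E, R), 'd g s d = d x].

Definition smooth_convex (L : R) (f : E -> R) : Prop :=
  [/\ convex_function [set: E] f,
      forall x, differentiable f x
    & forall x y, `|grad f x - grad f y| <= L * `|x - y|].

Definition hess (f : E -> R) (x : E) : 'Hom(E, 'Hom(E, R)) :=
  linfun ('d (grad f) x).

Definition twice_continuously_differentiable (C : set E) (phi : E -> R) : Prop :=
  exists (U : set E) (psi : E -> R),
    [/\ open U, C `<=` U, {in C, phi =1 psi}
      & forall x, U x -> [/\ differentiable psi x, differentiable (grad psi) x
                           & {for x, continuous (hess psi)}]].

(* A function phi : C -> R is encoded by a total function of which only the
   values on C are used. *)
Definition extend (C : set E) (phi : E -> R) (x : E) : \bar R :=
  if x \in C then (phi x)%:E else +oo%E.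

Definition subdifferential (h : E -> \bar R) (x : E) : set 'Hom(E, R) :=
  [set g | forall y, (h x + (g (y - x))%:E <= h y)%E].

Definition strongly_convex (sigma : R) (C : set E) (phi : E -> R) : Prop :=
  forall x y (g : 'Hom(E, R)), C x -> C y ->
    subdifferential (extend C phi) x g ->
    phi y - phi x - g (y - x) >= sigma / 2 * `|y - x| ^+ 2.

Definition econjugate (h : E -> \bar R) (s : 'Hom(E, R)) : \bar R :=
  ereal_sup [set ((s x)%:E - h x)%E | x in [set: E]].

(* [fine] only serves to land in R: the conjugates considered are finite. *)
Definition conjugate (C : set E) (phi : E -> R) (s : 'Hom(E, R)) : R :=
  fine (econjugate (extend C phi) s).

Definition bregman (g : 'Hom(E, R) -> R) (z w : 'Hom(E, R)) : R :=
  g z - g w - (z - w) (dual_grad g w).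

Definition minimizer (C : set E) (f : E -> R) (x : E) : Prop :=
  C x /\ forall y, C y -> f x <= f y.

End ConvexAnalysis.

(* Derivative relative to a set A of times; on `[0, +oo[ it is two-sided at
   t > 0 and one-sided at t = 0. *)
Section DerivativeWithin.
Context {R : realType} {V : normedModType R}.
Implicit Types (A : set R) (X : R -> V) (t : R).

Definition diff_quotient X t (s : R) : V := (s - t)^-1 *: (X s - X t).

Definition derivable_within A X t : Prop :=
  cvg (diff_quotient X t @ within A t^').

Definition derive_within A X t : V :=
  lim (diff_quotient X t @ within A t^').

End DerivativeWithin.

(* Lets the little-o notation of landau.v accept the filter of neighbourhoods
   of +oo in R. *)
Canonical pinfty_filter_on (R : numFieldType) :=
  FilterType (pinfty_nbhs R) filter_filter.

(* Main.v *)
(** Strong convexity and compactness make the maximum defining [phi^* s]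
    attained at a unique [p s], which is the gradient of [phi^*] at [s], and
    [sigma |p s' - p s|^2 <= (s' - s) (p s' - p s)]; along the flow this gives
    [sigma |X'|^2 <= <Z', X'>].  With the energy
    [W t = sigma t (f (X t) - f xs) + D (Z t, zs)], convexity of [f] yields
    [W' <= t sigma <grad f X, X'> = - t <Z', X'> <= - sigma t |X'|^2], so that
    [sigma t (f (X t) - f xs) <= W t <= W 0].  For the second claim, let [c] be
    the infimum of [|X'|^2] on [[0, t]]: then [W u + sigma c u^2 / 2] is
    nonincreasing on [[t/2, t]], whence
    [3/8 sigma c t^2 <= W (t/2) - W t], which tends to [0] because [W] is
    nonincreasing and nonnegative. *)
Require Import Defs.
From HB Require Import structures.
From mathcomp Require Import all_boot all_order all_algebra.
From mathcomp Require Import all_classical all_reals all_analysis.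
From mathcomp Require Import ring lra.

Set Implicit Arguments.
Unset Strict Implicit.
Unset Printing Implicit Defensive.

Import Order.TTheory GRing.Theory Num.Theory.
Import numFieldNormedType.Exports.
Local Open Scope classical_set_scope.
Local Open Scope ring_scope.

(** * Compactness and duality in finite-dimensional normed spaces *)

Section FiniteDimensionalSpaces.
Import VectorInternalTheory.
Context {R : realType}.

Lemma bounded_linear_map_continuous (V W : normedModType R)
    (g : {linear V -> W}) (M : R) :
  (forall x, `|g x| <= M * `|x|) -> continuous g.
Proof.
move=> hM; apply: bounded_linear_continuous.
apply/linear_boundedP; near=> r => x.
by apply: le_trans (hM x) _; rewrite ler_wpM2r//; near: r; exact: nbhs_pinfty_ge.
Unshelve. all: by end_near. Qed.

(** The coordinate maps [r2v] and [v2r] are bounded, so [A] is the continuous image of a closed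
    bounded set of row vectors. *)
Lemma vect_bounded_closed_compact (E : normedVectType R) (A : set E) (M : R) :
  closed A -> (forall x, A x -> `|x| <= M) -> compact A.
Proof.
move=> cA hA.
have [c c0 hc] := rV_linear_bounded
  [the {linear 'rV[R]_(dim E) -> E} of r2v].
have [d d0 hd] := vect_linear_bounded
  [the {linear E -> 'rV[R]_(dim E)} of v2r].
have cr := bounded_linear_map_continuous hc.
have -> : A = r2v @` (r2v @^-1` A).
  apply/seteqP; split=> [x Ax|_ [v Av <-] //].
  by exists (v2r x); rewrite /= v2rK.
apply: continuous_compact; first exact: continuous_subspaceT.
apply: bounded_closed_compact; last by apply: closed_comp => // v _; exact: cr.
exists (d * M); split => [|N dMN v /= Av]; first exact: num_real.
rewrite -(r2vK v); apply: le_trans (hd _) _; apply: ltW; apply: le_lt_trans dMN.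
by rewrite ler_wpM2l// hA.
Qed.

Lemma lfun_separates (E : normedVectType R) (x y : E) :
  (forall d : 'Hom(E, R), d x = d y) -> x = y.
Proof.
move=> dxy; pose b := vbasis {:E}.
rewrite (coord_vbasis (memvf x)) (coord_vbasis (memvf y)).
apply: eq_bigr => i _; congr (_ *: _).
by have := dxy (linfun (coord b i : {linear E -> R^o})); rewrite !lfunE.
Qed.

Lemma lfun_subl (E : normedVectType R) (d e : 'Hom(E, R)) x :
  (d - e) x = d x - e x.
Proof. by rewrite add_lfunE opp_lfunE. Qed.

Lemma lfun_subr (E : normedVectType R) (d : 'Hom(E, R)) x y :
  d (x - y) = d x - d y.
Proof. by rewrite linearB. Qed.

(** The image of [x] in the bidual, named so that it can carry a linear structure and serve as a
    differential. *)
Definition lfun_eval (E : normedVectType R) (x : E) (d : 'Hom(E, R)) : R := d x.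

Lemma lfun_eval_is_linear (E : normedVectType R) (x : E) :
  linear (@lfun_eval E x).
Proof. by move=> k d e; rewrite /lfun_eval add_lfunE scale_lfunE. Qed.

HB.instance Definition _ (E : normedVectType R) (x : E) :=
  GRing.isLinear.Build R 'Hom(E, R) R _ (@lfun_eval E x)
    (lfun_eval_is_linear x).

Lemma lfun_eval_continuous (E : normedVectType R) (x : E) :
  continuous (@lfun_eval E x).
Proof.
apply: (@bounded_linear_map_continuous _ _ _ `|x|) => d.
by rewrite mulrC; exact: le_opnorm.
Qed.

End FiniteDimensionalSpaces.

(** * Maximizers in the definition of the conjugate *)

Section Conjugate.
Context {R : realType} {E : normedVectType R}.
Implicit Types (C : set E) (phi : E -> R) (s d : 'Hom(E, R)).

Lemma gradE phi x v : grad phi x v = 'd phi x v.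
Proof. by rewrite /grad lfunE. Qed.

Lemma convex_ge_tangent C (g h : E -> R) x y :
  convex_set C -> convex_function C g -> {in C, g =1 h} -> C x -> C y ->
  differentiable h x -> g x + 'd h x (y - x) <= g y.
Proof.
move=> cC cg gh Cx Cy dh; rewrite -lerBrDl -deriveE//.
have /cvg_dnbhs_at_right := @diff_derivable _ _ _ _ _ (y - x) dh.
move=> /cvgr_to_le; apply; near=> t.
have t0 : 0 < t by [].
have t1 : t <= 1 by near: t; exact: nbhs_right_le.
pose p : {i01 R} := Itv01 (ltW t0) t1.
have xyE : t *: (y - x) + x = conv p (y : convex_lmodType E) x.
  rewrite /conv /= scalerBr scalerBl scale1r.
  by rewrite -addrA [- _ + x]addrC.
have Cyx : t *: (y - x) + x \in C.
  by rewrite xyE; apply: cC; exact: mem_set.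
have := cg p y x (mem_set Cy) (mem_set Cx).
rewrite -xyE gh// convRE /= -(gh x) ?inE// => le_t.
rewrite [_ *: _]mulrC ler_pdivrMr//; move: le_t; rewrite /unstable.onem; lra.
Unshelve. all: by end_near. Qed.

Definition conj_argmax C phi s (p : E) : Prop :=
  C p /\ forall y, C y -> s y - phi y <= s p - phi p.

Lemma conjugateE C phi s p :
  conj_argmax C phi s p -> conjugate C phi s = s p - phi p.
Proof.
move=> [Cp hp]; rewrite /conjugate.
suff -> : econjugate (extend C phi) s = (s p - phi p)%:E by [].
apply/eqP; rewrite eq_le; apply/andP; split.
  apply: ge_ereal_sup => _ [y _ <-]; rewrite /extend.
  by case: ifPn => [/set_mem Cy|_]; rewrite ?leNye// lee_fin hp.
by apply: ereal_sup_ubound; exists p => //; rewrite /extend mem_set.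
Qed.

Lemma conj_argmax_subdifferential C phi s p :
  conj_argmax C phi s p -> subdifferential (extend C phi) p s.
Proof.
move=> [Cp hp] y; rewrite /extend (mem_set Cp).
case: ifPn => [/set_mem Cy|_]; last by rewrite leey.
rewrite -EFinD lee_fin lfun_subr; have := hp _ Cy; lra.
Qed.

(** Each functional is a subgradient at its maximizer; adding the two strong convexity inequalities
    turns [sigma / 2] into [sigma]. *)
Lemma conj_argmax_monotone C phi sigma s s' p p' :
  strongly_convex sigma C phi ->
  conj_argmax C phi s p -> conj_argmax C phi s' p' ->
  sigma * `|p' - p| ^+ 2 <= (s' - s) (p' - p).
Proof.
move=> sc hp hp'.
have := sc _ _ _ hp.1 hp'.1 (conj_argmax_subdifferential hp).
have := sc _ _ _ hp'.1 hp.1 (conj_argmax_subdifferential hp').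
rewrite (distrC p p') lfun_subl !lfun_subr; lra.
Qed.

(** Strong convexity at one point [a] makes [s y - phi y] at most its value at [a] outside a ball
    around [a], so a maximum over the compact part of [C] in that ball is global. *)
Lemma conj_argmax_exists C phi sigma s :
  C !=set0 -> closed C -> convex_set C -> convex_function C phi ->
  0 < sigma -> strongly_convex sigma C phi ->
  twice_continuously_differentiable C phi ->
  exists p, conj_argmax C phi s p.
Proof.
move=> [a Ca] clC cC cphi sg0 sc [U [psi [oU CU phipsi dpsi]]].
have psid x : C x -> differentiable psi x by move=> /CU /dpsi [].
pose g := grad psi a.
have ga : subdifferential (extend C phi) a g.
  move=> y; rewrite /extend (mem_set Ca).
  case: ifPn => [/set_mem Cy|_]; last by rewrite leey.
  rewrite -EFinD lee_fin gradE.
  by apply: (convex_ge_tangent cC cphi phipsi) => //; exact: psid.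
(* Beyond this radius [sigma / 2 * |y - a|^2] dominates the linear term [|s - g| * |y - a|]. *)
pose M := 2 * `|s - g| / sigma.
have M0 : 0 <= M by rewrite divr_ge0 ?mulr_ge0// ltW.
pose K := C `&` [set x | `|x - a| <= M].
have Ka : K a by split => //=; rewrite subrr normr0.
have cK : compact K.
  apply: (@vect_bounded_closed_compact _ _ _ (M + `|a|)).
    apply: closedI => //.
    apply: (closed_comp (f := fun x : E => `|x - a| : R) (D := [set r | r <= M])).
      move=> x _; apply: (@continuous_comp _ _ _ (fun x : E => x - a) Num.norm).
        by apply: cvgB; [exact: cvg_id|exact: cvg_cst].
      exact: norm_continuous.
    exact: closed_le.
  move=> x [_ /= xa]; rewrite -{1}(subrK a x).
  by apply: le_trans (ler_normD _ _) _; rewrite lerD2r.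
have cs : {within K, continuous (fun x => s x - psi x)}.
  apply: continuous_in_subspaceT => x /set_mem[Cx _].
  apply: cvgB.
    by have [N _ hN] := vect_linear_bounded s; exact: (bounded_linear_map_continuous hN).
  by apply: differentiable_continuous; exact: psid.
have [p Kp hp] := compact_EVT_max (ex_intro _ a Ka) cK cs.
move/set_mem: Kp => [Cp pM].
exists p; split => // y Cy.
have [yM|yM] := leP `|y - a| M.
  have := hp y (mem_set (conj Cy yM)).
  by rewrite !phipsi ?inE.
(* Outside the ball, [y] is compared with [a], which lies in [K] and is thus no better than [p]. *)
have := hp a (mem_set Ka).
rewrite -!phipsi ?inE// => ap; apply: le_trans ap.
have := sc _ _ _ Ca Cy ga.
have := le_trans (ler_norm _) (le_opnorm (s - g) (y - a)).
rewrite -[opnorm _]/`|s - g|.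
rewrite lfun_subl !lfun_subr.
have : `|s - g| * `|y - a| <= sigma / 2 * `|y - a| ^+ 2.
  rewrite expr2 mulrA ler_wpM2r//.
  by move: yM; rewrite /M ltr_pdivrMr// => /ltW; lra.
lra.
Qed.

(** * Differentiability of the conjugate and its gradient *)

Section Gradient.
Context (C : set E) (phi : E -> R) (sigma : R).
Context (sigma_gt0 : 0 < sigma) (phi_sc : strongly_convex sigma C phi).
Context (argmax_ex : forall s, exists p, conj_argmax C phi s p).

(** With [q] the maximizer at [d + s], optimality of [p] and of [q] puts the remainder between 0 and
    [d (q - p)]; monotonicity gives [sigma * |q - p| <= |d|], so the remainder is at most
    [|d|^2 / sigma]. *)
Lemma conjugate_expansion s p : conj_argmax C phi s p ->
  conjugate C phi \o shift s =
  cst (conjugate C phi s) + lfun_eval p +o_ 0 id.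
Proof.
move=> hp; apply/eqaddoP => e e0.
have near0 : \forall d \near (0 : 'Hom(E, R)), `|d| <= sigma * e.
  by apply: nbhs0_le; exact: mulr_gt0.
near=> d; have de : `|d| <= sigma * e by near: d; exact: near0.
have [q hq] := argmax_ex (d + s).
rewrite /= /cst !fctE /= (conjugateE hp) (conjugateE hq) /lfun_eval.
have dqp : sigma * `|q - p| <= `|d|.
  have [->|qp] := eqVneq q p; first by rewrite subrr normr0 mulr0.
  have := conj_argmax_monotone phi_sc hp hq; rewrite addrK.
  have := le_trans (ler_norm _) (le_opnorm d (q - p)).
  move=> /[swap] /le_trans /[apply].
  by rewrite expr2 mulrA ler_pM2r// normr_gt0 subr_eq0.
have := hp.2 _ hq.1; have := hq.2 _ hp.1.
rewrite !add_lfunE => h1 h2.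
rewrite ger0_norm; last lra.
have h3 : d q - d p <= `|d| * `|q - p|.
  by rewrite -lfun_subr; exact: le_trans (ler_norm _) (le_opnorm _ _).
have : `|d| * `|q - p| <= e * `|d|.
  rewrite mulrC ler_wpM2r// -(ler_pM2l sigma_gt0); exact: le_trans dqp _.
lra.
Unshelve. all: by end_near. Qed.

Lemma diff_conjugate s p : conj_argmax C phi s p ->
  'd (conjugate C phi) s = lfun_eval p :> (_ -> _).
Proof.
move=> /conjugate_expansion; apply: diff_unique; exact: lfun_eval_continuous.
Qed.

Lemma differentiable_conjugate s : differentiable (conjugate C phi) s.
Proof.
have [p hp] := argmax_ex s.
apply/diff_locallyP; rewrite (diff_conjugate hp).
by split; [exact: lfun_eval_continuous|exact: conjugate_expansion].
Qed.

(** The choice made by [dual_grad] is harmless: the maximizer represents the differential, and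
    functionals separate points. *)
Lemma dual_grad_conjugate s :
  conj_argmax C phi s (dual_grad (conjugate C phi) s).
Proof.
have [p hp] := argmax_ex s.
suff -> : dual_grad (conjugate C phi) s = p by [].
apply: lfun_separates => d.
have /= <- := @getPex E [set x : E | forall d, 'd (conjugate C phi) s d = d x] _ d.
  by rewrite (diff_conjugate hp).
by exists p => d'; rewrite (diff_conjugate hp).
Qed.

End Gradient.
End Conjugate.

(** * From derivatives relative to the half-line to ordinary derivatives and continuity *)

Section OneSidedDerivative.
Context {R : realType} {V : normedModType R}.
Implicit Types (X : R -> V) (t : R).

(** For [t > 0] the half-line is a neighbourhood of [t], so increments with [|h| <= t] never leave
    it and the relative limit is the two-sided one. *)
Lemma derivable_within_derivable X t :
  0 < t -> derivable_within `[0, +oo[ X t ->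
  is_derive t 1 X (derive_within `[0, +oo[ X t).
Proof.
move=> t0 dX.
have shift_cvg : h + t @[h --> 0^'] --> within `[0, +oo[ t^'.
  move=> P tP; change (\forall h \near 0^', P (h + t)).
  have {}tP : \forall s \near t, s != t -> s \in `[0, +oo[ -> P s := tP.
  have {}tP : \forall h \near (0 : R), h + t != t -> h + t \in `[0, +oo[ -> P (h + t).
    by move: tP; rewrite (near_shift 0) subr0.
  change (\forall h \near (0 : R), h != 0 -> P (h + t)); near=> h => h0.
  have : h + t != t by rewrite -subr_eq0 addrK.
  have : h + t \in `[0, +oo[.
    rewrite in_itv /= andbT; have : `|h| <= t by near: h; exact: nbhs0_le.
    by rewrite ler_norml => /andP[+ _]; lra.
  by move=> /[swap]; near: h.
have : (fun h => h^-1 *: ((X \o shift t) (h *: 1) - X t)) @ 0^' -->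
    derive_within `[0, +oo[ X t.
  have -> : (fun h => h^-1 *: ((X \o shift t) (h *: 1) - X t)) =
      diff_quotient X t \o (fun h => h + t).
    by apply/funext => h; rewrite /diff_quotient /= addrK [_ *: 1]mulr1.
  exact: cvg_comp shift_cvg dX.
move=> Xl; apply: DeriveDef; first by apply/cvg_ex; eexists; exact: Xl.
exact: cvg_lim.
Unshelve. all: by end_near. Qed.

(** [X s - X t] is [s - t] times a convergent quotient. On the half-line this also covers
    [t = 0]. *)
Lemma derivable_within_cvg (A : set R) X t :
  derivable_within A X t -> X @ within A (nbhs t) --> X t.
Proof.
move=> dX.
have : (fun s => (s - t) *: diff_quotient X t s) @ within A t^' --> (0 : V).
  rewrite -(scale0r (derive_within A X t)); apply: cvgZ dX.
  have : (fun s : R => s - t) @ nbhs t --> (0 : R).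
    by rewrite -[X in _ --> X](subrr t); apply: cvgB; [exact: cvg_id|exact: cvg_cst].
  by move=> st; apply: cvg_trans st; apply: cvg_app => P; rewrite /dnbhs /within /=;
    apply: filterS => s Ps _ _.
move=> /cvgr0Pnorm_le qX; apply/cvgrPdist_le => e e0.
have {}qX : \forall s \near t, s != t -> A s ->
  `|(s - t) *: diff_quotient X t s| <= e := qX e e0.
change (\forall s \near t, A s -> `|X t - X s| <= e).
apply: filterS qX => s + As.
(* The quotient is controlled on a punctured neighbourhood only, so [s = t] is treated apart. *)
have [->|st] := eqVneq s t; first by move=> _; rewrite subrr normr0 ltW.
move=> /(_ isT As) /=; rewrite /diff_quotient scalerA divff ?subr_eq0// scale1r.
by rewrite distrC.
Qed.

Lemma is_derive_diff_comp (W : normedModType R) (g : V -> W) X t dX :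
  differentiable g (X t) -> is_derive t 1 X dX ->
  is_derive t 1 (g \o X) ('d g (X t) dX).
Proof.
move=> dg [/derivable1_diffP dfX <-].
have dgX : differentiable (g \o X) t by exact: differentiable_comp.
apply: DeriveDef; first exact/derivable1_diffP.
by rewrite !deriveE// diff_comp.
Qed.

End OneSidedDerivative.

(** The limit is taken in [z_ i (x_ i) <= z (x_ i) + |z_ i - z| * |x_ i|], whose right side tends to
    [z x]; this replaces joint continuity of the pairing. *)
Lemma lfun_apply_ge_cvg (R : realType) (E : normedVectType R) (T : Type)
    (F : set_system T) (FF : ProperFilter F) (c : R)
    (x_ : T -> E) (x : E) (z_ : T -> 'Hom(E, R)) (z : 'Hom(E, R)) :
  x_ @ F --> x -> z_ @ F --> z ->
  (\forall i \near F, c * `|x_ i| ^+ 2 <= z_ i (x_ i)) ->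
  c * `|x| ^+ 2 <= z x.
Proof.
move=> xx zz le_xz.
have [M _ hM] := vect_linear_bounded z.
have zc := bounded_linear_map_continuous hM.
have nx : `|x_ i| @[i --> F] --> `|x| by exact: cvg_norm.
have lhs : c * `|x_ i| ^+ 2 @[i --> F] --> c * `|x| ^+ 2.
  by apply: cvgM; [exact: cvg_cst|exact: (cvgM nx nx)].
have rhs : z (x_ i) + `|z_ i - z| * `|x_ i| @[i --> F] --> z x + `|z - z| * `|x|.
  apply: cvgD; first exact: (cvg_comp _ _ xx (zc x)).
  apply: (cvgM _ nx); apply: cvg_norm; apply: (cvgB zz); exact: cvg_cst.
have lr : z (x_ i) + `|z_ i - z| * `|x_ i| - c * `|x_ i| ^+ 2 @[i --> F] -->
    z x - c * `|x| ^+ 2.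
  rewrite -[z x]addr0 -[X in z x + X](mul0r `|x|) -(@normr0 R 'Hom(E, R)).
  by rewrite -(subrr z); exact: (cvgB rhs lhs).
rewrite -subr_ge0; apply: (cvgr_to_ge lr); near=> i.
have le_i : c * `|x_ i| ^+ 2 <= z_ i (x_ i) by near: i.
rewrite subr_ge0; apply: le_trans le_i _; have := le_trans (ler_norm _) (le_opnorm (z_ i - z) (x_ i)).
rewrite -[opnorm _]/`|z_ i - z| lfun_subl; lra.
Unshelve. all: by end_near. Qed.

(** * The flow and the dissipation of its energy *)

Section MirrorDescentFlow.
Context {R : realType} {E : normedVectType R} (C : set E) (f phi : E -> R).
Context (sigma : R) (xs : E) (zs : 'Hom(E, R)).
Context (X : R -> E) (Z : R -> 'Hom(E, R)).
Local Notation phic := (conjugate C phi).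
Local Notation D := (derive_within `[0, +oo[).

Context (f_convex : convex_function [set: E] f).
Context (f_diff : forall x, differentiable f x).
Context (sigma_gt0 : 0 < sigma) (phi_sc : strongly_convex sigma C phi).
Context (argmax_ex : forall s, exists p, conj_argmax C phi s p).
Context (xs_min : minimizer C f xs) (zsE : dual_grad phic zs = xs).
Context (dX : forall t : R, 0 <= t -> derivable_within `[0, +oo[ X t).
Context (dZ : forall t : R, 0 <= t -> derivable_within `[0, +oo[ Z t).
Context (Z'E : forall t : R, 0 <= t -> D Z t = - (sigma *: grad f (X t))).
Context (XE : forall t : R, 0 <= t -> X t = dual_grad phic (Z t)).

Lemma flow_argmax (t : R) : 0 <= t -> conj_argmax C phi (Z t) (X t).
Proof. by move=> t0; rewrite XE//; exact: (dual_grad_conjugate sigma_gt0 phi_sc argmax_ex). Qed.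

Lemma zs_argmax : conj_argmax C phi zs xs.
Proof. by rewrite -zsE; exact: (dual_grad_conjugate sigma_gt0 phi_sc argmax_ex). Qed.

(** Monotonicity of the maximizers, applied at times [t] and [t + h] and divided by [h^2], passes to
    the limit. *)
Lemma flow_speed_bound (t : R) : 0 < t -> sigma * `|D X t| ^+ 2 <= (D Z t) (D X t).
Proof.
move=> t0; have t0' := ltW t0.
have [Xd <-] := derivable_within_derivable t0 (dX t0').
have [Zd <-] := derivable_within_derivable t0 (dZ t0').
apply: (@lfun_apply_ge_cvg _ _ _ _ _ _ _ _ _ _ Xd Zd).
near=> h => /=.
have h0 : h != 0 by near: h; exact: nbhs_dnbhs_neq.
have ht : 0 <= h *: 1 + t.
  have : `|h| <= t by near: h; exact: dnbhs0_le.
  by rewrite [_ *: _]mulr1 ler_norml => /andP[+ _]; lra.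
have := conj_argmax_monotone phi_sc (flow_argmax t0') (flow_argmax ht).
move: (X _ - X t) (Z _ - Z t) => x z xz.
rewrite normrZ exprMn scale_lfunE linearZ /= real_normK ?num_real//.
rewrite [_ *: _]mulrA -expr2 mulrCA ler_wpM2l// ?sqr_ge0//.
Unshelve. all: by end_near. Qed.

Definition energy (t : R) : R := sigma * t * (f (X t) - f xs) + bregman phic (Z t) zs.

Lemma energyE (t : R) : energy t =
  sigma * t * (f (X t) - f xs) +
  (phic (Z t) - phic zs - (lfun_eval xs (Z t) - lfun_eval xs zs)).
Proof. by rewrite /energy /bregman zsE lfun_subl. Qed.

(** Once the conjugates are evaluated at their maximizers, this is the optimality of [X t] for [Z t]
    tested at [xs]. *)
Lemma bregman_ge0 (t : R) : 0 <= t -> 0 <= bregman phic (Z t) zs.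
Proof.
move=> t0; have Xt := flow_argmax t0; rewrite /bregman zsE lfun_subl.
rewrite (conjugateE Xt) (conjugateE zs_argmax).
have := Xt.2 _ xs_min.1; lra.
Qed.

Lemma energy_ge0 (t : R) : 0 <= t -> 0 <= energy t.
Proof.
move=> t0; apply: addr_ge0; last exact: bregman_ge0.
apply: mulr_ge0; first by rewrite mulr_ge0// ltW.
by rewrite subr_ge0; apply: xs_min.2; case: (flow_argmax t0).
Qed.

(** The differential of the conjugate at [Z t] is evaluation at [X t], and the linear term
    contributes evaluation at [xs]; hence the pairing with [X t - xs]. *)
Lemma is_derive_energy (t : R) : 0 < t ->
  is_derive t 1 energy
    (sigma * (f (X t) - f xs) + sigma * t * 'd f (X t) (D X t)
     + (D Z t) (X t - xs)).
Proof.
move=> t0; have t0' := ltW t0; have Xt := flow_argmax t0'.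
have Xd := derivable_within_derivable t0 (dX t0').
have Zd := derivable_within_derivable t0 (dZ t0').
have fd := is_derive_diff_comp (f_diff (X t)) Xd.
have pd := is_derive_diff_comp (differentiable_conjugate sigma_gt0 phi_sc argmax_ex (Z t)) Zd.
have ed := is_derive_diff_comp (linear_differentiable (Z t) (@lfun_eval_continuous R E xs)) Zd.
rewrite (diff_conjugate sigma_gt0 phi_sc argmax_ex Xt) in pd.
rewrite (diff_lin _ (@lfun_eval_continuous R E xs)) in ed.
have -> : energy = (sigma \*: id) * (f \o X - cst (f xs)) +
    (phic \o Z - cst (phic zs) - (lfun_eval xs \o Z - cst (lfun_eval xs zs))).
  by apply/funext => u; rewrite energyE.
apply: is_derive_eq.
rewrite !fctE /= lfun_subr /lfun_eval !subr0.
rewrite /GRing.scale /=; ring.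
Qed.

(** The tangent inequality of [f] at [X t], tested at [xs], absorbs the first term into the third,
    and [flow_speed_bound] bounds the middle one. *)
Lemma energy_derive_le (t : R) : 0 < t ->
  sigma * (f (X t) - f xs) + sigma * t * 'd f (X t) (D X t)
  + (D Z t) (X t - xs) <= - (sigma * t * `|D X t| ^+ 2).
Proof.
move=> t0; have t0' := ltW t0.
have Z'v v : (D Z t) v = - (sigma * 'd f (X t) v).
  by rewrite Z'E// opp_lfunE scale_lfunE gradE.
have := flow_speed_bound t0; rewrite !Z'v => /(ler_wpM2l t0').
have := @convex_ge_tangent _ _ setT f f (X t) xs (fun _ _ _ _ _ => in_setT _)
  f_convex (fun _ _ => erefl) I I (f_diff _).
rewrite -opprB linearN /= => /(ler_wpM2l (ltW sigma_gt0)).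
move: ('d f (X t) _) ('d f (X t) _) => a b; lra.
Qed.

(** Monotonicity on a closed interval starting at 0 needs continuity at 0, where only the one-sided
    derivative is given. *)
Lemma energy_continuous (A : set R) : A `<=` `[0, +oo[ ->
  {within A, continuous energy}.
Proof.
move=> A0; rewrite (funext energyE); apply/subspace_continuousP => t At.
have t0 : 0 <= t by have := A0 _ At; rewrite /= in_itv /= andbT.
have Xc : X @ within A (nbhs t) --> X t.
  by apply: cvg_trans (derivable_within_cvg (dX t0)); apply: cvg_app; exact: within_subset.
have Zc : Z @ within A (nbhs t) --> Z t.
  by apply: cvg_trans (derivable_within_cvg (dZ t0)); apply: cvg_app; exact: within_subset.
have fc := differentiable_continuous (f_diff (X t)).
have pc := differentiable_continuous
  (differentiable_conjugate sigma_gt0 phi_sc argmax_ex (Z t)).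
apply: cvgD.
  apply: cvgM; last by apply: cvgB; [exact: (cvg_comp _ _ Xc fc)|exact: cvg_cst].
  by apply: cvgM; [exact: cvg_cst|exact: cvg_within].
apply: cvgB.
  by apply: cvgB; [exact: (cvg_comp _ _ Zc pc)|exact: cvg_cst].
apply: cvgB; last exact: cvg_cst.
exact: (cvg_comp _ _ Zc (@lfun_eval_continuous R E xs (Z t))).
Qed.

(** The derivative of [V] at [u] is at most [sigma * u * (c - |D X u|^2)], hence nonpositive. Taking
    [c = 0] gives plain monotonicity of the energy. *)
Lemma energy_decrease (a b c : R) : 0 <= a -> a <= b ->
  (forall u : R, a < u -> u < b -> c <= `|D X u| ^+ 2) ->
  energy b + sigma * c / 2 * b ^+ 2 <= energy a + sigma * c / 2 * a ^+ 2.
Proof.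
move=> a0 ab hc.
pose V : R -> R := energy + (fun u : R => sigma * c / 2 * u ^+ 2).
pose k := sigma * c / 2.
have dV (u : R) : 0 < u -> is_derive u 1 V
    (sigma * (f (X u) - f xs) + sigma * u * 'd f (X u) (D X u)
     + (D Z u) (X u - xs) + sigma * c * u).
  move=> u0; have eu := is_derive_energy u0.
  have qu : is_derive u 1 (fun u : R => sigma * c / 2 * u ^+ 2) (sigma * c * u).
    have -> : (fun u : R => sigma * c / 2 * u ^+ 2) = k \*: (fun u : R => u ^+ 2).
      by [].
    by apply: is_derive_eq; rewrite /GRing.scale /= /k; field.
  exact: is_deriveD.
have pos (u : R) : u \in `]a, b[ -> 0 < u.
  by rewrite in_itv /= => /andP[au _]; exact: le_lt_trans au.
apply: (@ler0_derive1_nincr _ V a b) => // u.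
- by move=> /pos u0; case: (dV u u0).
- move=> uab; have u0 := pos u uab.
  rewrite derive1E; have [_ ->] := dV u u0.
  move: uab; rewrite in_itv /= => /andP[au ub].
  have := energy_derive_le u0.
  have : sigma * u * c <= sigma * u * `|D X u| ^+ 2.
    by rewrite ler_wpM2l ?hc// mulr_ge0// ltW.
  lra.
- apply: (@continuousD _ _ (subspace `[a, b])).
    apply: energy_continuous => v /=; rewrite !in_itv /= andbT => /andP[av _].
    exact: le_trans av.
  apply: continuous_subspaceT => v; apply: cvgM; first exact: cvg_cst.
  exact: exprn_continuous.
Qed.

(** * The two convergence rates *)

Lemma objective_rate (t : R) :
  0 < t -> f (X t) - f xs <= bregman phic (Z 0) zs / (t * sigma).
Proof.
move=> t0; rewrite ler_pdivlMr ?mulr_gt0//.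
(* At time 0 the factor [t] kills the objective term, so the energy is just the divergence. *)
have := @energy_decrease 0 t 0 (lexx _) (ltW t0) (fun _ _ _ => sqr_ge0 _).
have := bregman_ge0 (ltW t0); rewrite /energy; lra.
Qed.

Lemma inf_speed_rate :
  (fun t : R => inf [set `|D X u| ^+ 2 | u in `[0, t]])
    =o_ (pinfty_nbhs R) (fun t : R => 1 / t ^+ 2).
Proof.
apply/eqoP => e e0.
pose S := energy @` `[0, +oo[.
have S0 : has_inf S.
  split; first by exists (energy 0), 0 => //=; rewrite in_itv /= lexx.
  exists 0 => _ [t /= t0 <-]; apply: energy_ge0.
  by move: t0; rewrite in_itv /= andbT.
(* The factor [3 / 8] comes from [sigma * c / 2 * (t^2 - (t / 2)^2) = 3 / 8 * sigma * c * t^2]. *)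
pose del := 3 / 8 * sigma * e.
have del0 : 0 < del by rewrite !mulr_gt0.
have [_ [T /= T0 <-] WT] := inf_adherent del0 S0.
move: T0; rewrite in_itv /= andbT => T0.
near=> t.
have t0 : 0 < t by near: t; exact: nbhs_pinfty_gt.
(* This puts [t / 2] past [T], so both [energy (t / 2)] and [energy t] lie within [del] of the
   infimum of the energy. *)
have Tt : 2 * T <= t by near: t; apply: nbhs_pinfty_ge; exact: num_real.
set c := inf _.
have lbA : has_lbound [set `|D X u| ^+ 2 | u in `[0, t]].
  by exists 0 => _ [u _ <-]; exact: sqr_ge0.
have c0 : 0 <= c.
  apply: lb_le_inf => [|_ [u _ <-]]; last exact: sqr_ge0.
  by exists (`|D X 0| ^+ 2), 0 => //=; rewrite in_itv /= lexx ltW.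
have t2 : 0 <= t / 2 by rewrite divr_ge0// ltW.
have t2t : t / 2 <= t by lra.
have Tt2 : T <= t / 2 by lra.
have hcu u : t / 2 < u -> u < t -> c <= `|D X u| ^+ 2.
  move=> ul ut; apply: ge_inf => //; exists u => //=; rewrite in_itv /= (ltW ut) andbT.
  exact: ltW (le_lt_trans t2 ul).
have := energy_decrease t2 t2t hcu.
have := @energy_decrease T (t / 2) 0 T0 Tt2 (fun _ _ _ => sqr_ge0 _).
have : inf S <= energy t.
  by apply: ge_inf; [case: S0|exists t => //=; rewrite in_itv /= ltW].
rewrite !ger0_norm//; last by rewrite divr_ge0// sqr_ge0.
rewrite mul1r ler_pdivlMr ?exprn_gt0//.
move=> h1 h2 h3.
(* Chaining the bounds gives [3 / 8 * sigma * c * t^2 <= energy (t / 2) - energy t < del]. *)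
rewrite -(ler_pM2l (_ : 0 < 3 / 8 * sigma)) ?mulr_gt0// -/del.
move: WT h1 h2 h3; rewrite exprMn; lra.
Unshelve. all: by end_near. Qed.

End MirrorDescentFlow.

Theorem corollary1 (R : realType) (E : normedVectType R) (C : set E)
    (L sigma : R) (f phi : E -> R) (xs x0 : E) (zs z0 : 'Hom(E, R))
    (X : R -> E) (Z : R -> 'Hom(E, R)) :
  C !=set0 -> closed C -> convex_set C ->
  smooth_convex L f ->
  convex_function C phi ->
  0 < sigma -> strongly_convex sigma C phi ->
  twice_continuously_differentiable C phi ->
  minimizer C f xs ->
  dual_grad (conjugate C phi) zs = xs ->
  dual_grad (conjugate C phi) z0 = x0 ->
  (forall t : R, 0 <= t -> derivable_within `[0, +oo[ X t) ->
  (forall t : R, 0 <= t -> derivable_within `[0, +oo[ Z t) ->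
  (forall t : R, 0 <= t ->
    derive_within `[0, +oo[ Z t = - (sigma *: grad f (X t))) ->
  (forall t : R, 0 <= t -> X t = dual_grad (conjugate C phi) (Z t)) ->
  Z 0 = z0 -> X 0 = x0 ->
  (forall t : R, 0 < t ->
    f (X t) - f xs <= bregman (conjugate C phi) z0 zs / (t * sigma)) /\
  (fun t : R => inf [set `|derive_within `[0, +oo[ X u| ^+ 2 | u in `[0, t]])
    =o_ (pinfty_nbhs R) (fun t : R => 1 / t ^+ 2).
Proof.
move=> C0 clC cC [fc fd _] pc sg0 psc p2 xsm zsE _ dX dZ Z'E XE <- _.
have amax s := conj_argmax_exists s C0 clC cC pc sg0 psc p2.
split=> [t|].
  exact: (objective_rate fc fd sg0 psc amax xsm zsE dX dZ Z'E XE).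
exact: (inf_speed_rate fc fd sg0 psc amax xsm zsE dX dZ Z'E XE).
Qed.
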